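(* Let $f\colon X\to X$ be a continuous map on a compact metric space $X$. Let $\mathsf P$ be a finite poset with $I$ elements, let $R\colon\mathsf O(\mathsf P)\to\mathsf R\subset\mathsf{Rep}(X,f)$ be a lattice isomorphism onto a sublattice $\mathsf R$ of $\mathsf{Rep}(X,f)$, and let $\pi\colon\mathsf P\to\{1,2,\dots,I\}$ be a bijective, order-preserving map. Let $p_i=\pi^{-1}(i)$ and $\mu_i=\downarrow p_i\in\mathsf O(\mathsf P)$ for $i=1,\dots,I$. Then there exist $\epsilon_1,\dots,\epsilon_I>0$ such that, if $N_1,\dots,N_I\subset X$ are compact sets satisfying $$B_{\epsilon_i/2}(R(\mu_i))\subset N_i\subset B_{\epsilon_i}(R(\mu_i)),\qquad i=1,\dots,I,$$ then each $N_i$ is a repelling neighborhood for $f$. Furthermore, the map $U\colon\mathsf O(\mathsf P)\to\mathsf{RNbhd}(X,f)$ determined by $$U(\mu_1)=N_1,\qquad U(\mu_{i+1})=N_{i+1}\cup U(\overleftarrow{\mu_{i+1}})$$ is a lift of $R$ through $\alpha\colon\mathsf{RNbhd}(X,f)\to\mathsf{Rep}(X,f)$; that is, $U$ is a lattice homomorphism and $\alpha(U(\beta),f)=R(\beta)$ for all $\beta\in\mathsf O(\mathsf P)$.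
   Context: Lattices: all lattices are bounded and distributive; lattice homomorphisms preserve $0$ and $1$, and sublattices contain $0$ and $1$. For a finite poset $\mathsf P$, $\downarrow p=\{q\in\mathsf P : q\le p\}$, and $\mathsf O(\mathsf P)$ is the lattice of down-sets of $\mathsf P$ under $\cup,\cap$. Each $\mu=\downarrow p$ is join-irreducible in $\mathsf O(\mathsf P)$, and $\overleftarrow{\mu}=\mu\setminus\{p\}$ denotes its unique immediate predecessor. ''Determined by'' means extended by joins: $U(\varnothing)=\varnothing$ and $U(\beta)=\bigcup_{p_i\in\beta}U(\mu_i)$ for $\beta\in\mathsf O(\mathsf P)$ (so the displayed formula is a recursion on $i$). A lift of $g\colon\mathsf L\to\mathsf K$ through $h\colon\mathsf H\to\mathsf K$ is a lattice homomorphism $\ell\colon\mathsf L\to\mathsf H$ with $g=h\circ\ell$. Dynamics: $f$ is not assumed injective or surjective. For $U\subset X$, $\alpha(U,f)=\bigcap_{n\ge0}\mathrm{cl}\big(\bigcup_{k\ge n}f^{-k}(U)\big)$, with $f^{-k}(U)=(f^k)^{-1}(U)$. $U$ is a repelling neighborhood if $\alpha(U,f)\subset\mathrm{int}(U)$; a repeller is a set of the form $\alpha(U,f)$ with $U$ a repelling neighborhood. $\mathsf{RNbhd}(X,f)$ (repelling neighborhoods) and $\mathsf{Rep}(X,f)$ (repellers) are lattices with $\vee=\cup$, $\wedge=\cap$, $0=\varnothing$, $1=X$. $B_\epsilon(S)$ is the open $\epsilon$-neighborhood of $S\subset X$. *)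

(* Defs.v *)
From HB Require Import structures.
From mathcomp Require Import all_boot all_order all_algebra.
From mathcomp Require Import boolp classical_sets functions reals topology.

Set Implicit Arguments.
Unset Strict Implicit.
Unset Printing Implicit Defensive.

Import Order.TTheory GRing.Theory Num.Theory.
(* orders [{set P}] by inclusion, with meet [:&:] and join [:|:] *)
Import Order.DefaultSetSubsetOrder.

Section DownSets.
Context {d : Order.disp_t} {P : finPOrderType d}.
Implicit Types (p q : P).

Definition is_downset (A : {set P}) : bool :=
  [forall p in A, forall q, (q <= p)%O ==> (q \in A)].

Lemma is_downsetP (A : {set P}) :
  reflect (forall p q, p \in A -> (q <= p)%O -> q \in A) (is_downset A).
Proof.
apply: (iffP forall_inP) => [h p q pA qp|h p pA].
  by have /forallP/(_ q)/implyP := h p pA; apply.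
by apply/forallP => q; apply/implyP; apply: h.
Qed.

Lemma is_downsetI (A B : {set P}) :
  is_downset A -> is_downset B -> is_downset (A :&: B).
Proof.
move=> /is_downsetP hA /is_downsetP hB; apply/is_downsetP => p q.
by move=> /setIP[pA pB] qp; apply/setIP; split; [apply: hA qp|apply: hB qp].
Qed.

Lemma is_downsetU (A B : {set P}) :
  is_downset A -> is_downset B -> is_downset (A :|: B).
Proof.
move=> /is_downsetP hA /is_downsetP hB; apply/is_downsetP => p q.
by move=> /setUP[pA|pB] qp; apply/setUP; [left; apply: hA qp|right; apply: hB qp].
Qed.

Lemma is_downset0 : is_downset (finset.set0 : {set P}).
Proof. by apply/is_downsetP => p q; rewrite finset.in_set0. Qed.

Lemma is_downsetT : is_downset [set: P].
Proof. by apply/is_downsetP => p q _ _; rewrite finset.in_setT. Qed.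

End DownSets.

Section DownSetLattice.
Context {d : Order.disp_t} (P : finPOrderType d).
Implicit Types (p q : P).

Record downset := Downset {
  downset_set :> {set P};
  downset_setP : is_downset downset_set }.

HB.instance Definition _ := [isSub for downset_set].
HB.instance Definition _ := [Choice of downset by <:].

Let S : {pred {set P}} := @is_downset d P.

Fact downset_meet_closed : Order.ClosedPredicates.meet_closed S.
Proof. by move=> A B hA hB; apply: is_downsetI. Qed.

Fact downset_join_closed : Order.ClosedPredicates.join_closed S.
Proof. by move=> A B hA hB; apply: is_downsetU. Qed.

Fact downset_bot : \bot%O \in S.
Proof. exact: is_downset0. Qed.

Fact downset_top : \top%O \in S.
Proof. exact: is_downsetT. Qed.

Fact downset_display : Order.disp_t. Proof. by []. Qed.

HB.instance Definition _ :=
  @Order.SubChoice_isTBSubLattice.Build _ {set P} S downset_display downset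
    downset_meet_closed downset_join_closed downset_bot downset_top.

Fact principal_is_downset p : is_downset [set q | (q <= p)%O].
Proof. by apply/is_downsetP => q r; rewrite !inE => /[swap]; apply: le_trans. Qed.

Definition principal p : downset := Downset (principal_is_downset p).

(* The unique immediate predecessor of [principal p] among the down-sets. *)
Fact principal_pred_is_downset p : is_downset (principal p :\ p).
Proof.
apply/is_downsetP => q r; rewrite !inE => /andP[qNp qp] rq.
rewrite (le_trans rq qp) andbT; apply: contraNneq qNp => rp.
by rewrite eq_le qp -rp rq.
Qed.

Definition principal_pred p : downset := Downset (principal_pred_is_downset p).

End DownSetLattice.

Local Open Scope classical_set_scope.

Section Dynamics.
Context {X : topologicalType} (f : X -> X).

Definition alpha (U : set X) : set X :=
  \bigcap_n closure (\bigcup_(k in [set k | (n <= k)%N]) (iter k f @^-1` U)).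

Definition repelling_nbhd (U : set X) : Prop := alpha U `<=` interior U.

Definition repeller (A : set X) : Prop :=
  exists2 U, repelling_nbhd U & A = alpha U.

End Dynamics.

(* The library's [{tblmorphism _ -> _}] only preserves the bounds, not meets and
   joins, hence this predicate. *)
Definition bounded_lattice_hom {d1 d2 : Order.disp_t} {T1 : tbLatticeType d1}
    {T2 : tbLatticeType d2} (g : T1 -> T2) : Prop :=
  [/\ g \bot%O = \bot%O, g \top%O = \top%O,
      {morph g : x y / (x `|` y)%O} & {morph g : x y / (x `&` y)%O}].

(* Sublattices share the bounds of the ambient lattice. *)
Definition sublattice_of {X : Type} (M L : set (set X)) : Prop :=
  [/\ L `<=` M, L set0, L setT,
      forall A B, L A -> L B -> L (A `|` B) &
      forall A B, L A -> L B -> L (A `&` B)].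

Definition eps_nbhd {K : realType} {X : metricType K} (e : K) (S : set X)
    : set X :=
  \bigcup_(x in S) ball x e.

Section Recursion.
Context {d : Order.disp_t} {P : finPOrderType d} {X : Type}.

(* [p i] is the element of [P] with label [i]; labels start at 0, so [p i] and
   [N i] are the objects usually indexed by [i + 1]. *)
Definition determined_by {I : nat} (p : 'I_I -> P) (N : 'I_I -> set X)
    (U : downset P -> set X) : Prop :=
  [/\ forall i : 'I_I, i = 0%N :> nat -> U (principal (p i)) = N i,
      forall i j : 'I_I, j = i.+1 :> nat ->
        U (principal (p j)) = N j `|` U (principal_pred (p j)),
      U \bot%O = set0 &
      forall beta : downset P,
        U beta = \bigcup_(i in [set i | p i \in (beta : {set P})])
                   U (principal (p i))].

End Recursion.

(* Main.v *)
Require Import Defs.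
From HB Require Import structures.
From mathcomp Require Import all_boot all_order all_algebra.
From mathcomp Require Import boolp classical_sets functions reals topology.

Local Open Scope classical_set_scope.
Local Open Scope ring_scope.

Import Order.TTheory GRing.Theory Num.Theory.

(** Unfolding the recursion, [U beta] is the union of the [N i] with [p i] in
    [beta] ([downset_union]); it is the only map obeying the recursion because
    the elements strictly below [p j] carry smaller labels
    ([determined_by_unique]).  Write [A i] for [R (principal (p i))].  Since [R]
    is a homomorphism, [R beta] is the union of the same [A i]
    ([hom_bigcup_principal]), so everything reduces to three facts about the
    [N i].

    Dynamics: [A i = alpha f W] for some repelling neighborhood [W], and any [N]
    with [A i] in its interior and [N] inside [W] satisfies [alpha f N = A i]
    ([alpha_squeeze]).  A small radius puts [N i] in that position, and [alpha]
    commutes with finite unions ([alphaU]), so [alpha f (U beta) = R beta] and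
    [U beta] is repelling.

    Joins and bounds: [U] preserves joins by construction, and [U \top] is
    everything because the [A i] already cover the space.

    Meets: this is the only constraint relating different radii.  For
    incomparable [p i] and [p j] the intersection of [N i] and [N j] must lie in
    the union of the [N r] with [p r] below both.  The same is true of the
    [A i], as [R] preserves meets; hence, by compactness, it is true of the
    [e]-neighborhoods of [A i] and [A j] against the union of the half-radius
    neighborhoods of the [A r], once [e] is small ([near_eps_nbhdI]).  Those [r]
    have labels below both [i] and [j], so radii can be chosen in the order of
    the labels ([exists_admissible_radii]).  Choosing them nonincreasing lets the
    smaller of two labels take care of the pair: the later radius can only
    shrink. *)

(** * Repellers and repelling neighborhoods *)

Section Repellers.
Context {X : topologicalType} (f : X -> X).
Implicit Types (A U V W N : set X).

Lemma alphaS U V : U `<=` V -> alpha f U `<=` alpha f V.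
Proof.
move=> UV x ax n _; apply: closure_subset (ax n I) => y [k nk Uy].
by exists k => //; apply: UV.
Qed.

(** The tails [\bigcup_(k >= n) f^-k U] decrease with [n]: a point which is
    outside the [n]-th closure for [U] and outside the [m]-th one for [V] is
    outside the closure of rank [maxn n m] for the union. *)
Lemma alphaU U V : alpha f (U `|` V) = alpha f U `|` alpha f V.
Proof.
apply/seteqP; split=> [x ax|x [|]]; last first.
- by apply: alphaS; apply: subsetUr.
- by apply: alphaS; apply: subsetUl.
apply: contrapT => /not_orP[/existsNP[n /not_implyP[_ nU]]].
move=> /existsNP[m /not_implyP[_ mV]].
have := ax (maxn n m) I.
rewrite -[X in closure X](_ : \bigcup_(k in [set k | (maxn n m <= k)%N])
    (iter k f @^-1` U) `|` \bigcup_(k in [set k | (maxn n m <= k)%N])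
    (iter k f @^-1` V) = _); last first.
  by rewrite -bigcupU; apply: eq_bigcupr => k _; rewrite preimage_setU.
rewrite closureU => -[cU|cV]; [apply: nU|apply: mV].
- apply: closure_subset cU; apply: bigcup_sub => k /= nmk y Uy; exists k => //=.
  exact: leq_trans (leq_maxl _ _) nmk.
- apply: closure_subset cV; apply: bigcup_sub => k /= nmk y Vy; exists k => //=.
  exact: leq_trans (leq_maxr _ _) nmk.
Qed.

Lemma alpha0 : alpha f set0 = set0.
Proof.
apply/seteqP; split=> // x /(_ 0%N I).
rewrite (_ : \bigcup_(_ in _) _ = set0) ?closure0//.
by apply/seteqP; split=> // y [].
Qed.

Lemma closed_alpha U : closed (alpha f U).
Proof. by apply: closed_bigI => n _; apply: closed_closure. Qed.

(** If [x] is a limit of points whose orbits enter [U] after arbitrarily long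
    times, so is [f x], by continuity, with times shortened by one. *)
Lemma alpha_forward_invariant U :
  continuous f -> alpha f U `<=` f @^-1` alpha f U.
Proof.
move=> cf x ax n _ B /= fxB.
have [y [[k /= nk Uy] By]] := ax n.+1 I _ (cf x _ fxB).
exists (f y); split=> //; case: k nk Uy => // k nk Uy; exists k => //=.
by rewrite /= -iterSr.
Qed.

Lemma sub_alpha_forward_invariant A : A `<=` f @^-1` A -> A `<=` alpha f A.
Proof.
move=> fA x Ax n _; apply: subset_closure; exists n => //=.
by elim: n => //= n; apply: fA.
Qed.

(** With [A := alpha f W], forward invariance and [A `<=` N] give
    [A `<=` alpha f A `<=` alpha f N], while [N `<=` W] gives
    [alpha f N `<=` A]. *)
Lemma alpha_squeeze W N : continuous f ->
  alpha f W `<=` interior N -> N `<=` W -> alpha f N = alpha f W.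
Proof.
move=> cf WN NW; apply/seteqP; split; first exact: alphaS.
have WNs : alpha f W `<=` N by apply: subset_trans WN _; apply: interior_subset.
apply: subset_trans (alphaS _ _ WNs).
exact/sub_alpha_forward_invariant/alpha_forward_invariant.
Qed.

Lemma alpha_bigcup (I : finType) (Q : pred I) (N : I -> set X) :
  alpha f (\bigcup_(i in [set i | Q i]) N i) =
  \bigcup_(i in [set i | Q i]) alpha f (N i).
Proof.
have E (g : I -> set X) :
  \bigcup_(i in [set i | Q i]) g i = \big[setU/set0]_(i | Q i) g i.
  exact: (bigcup_pred Q g).
by rewrite !E; apply: (big_morph _ alphaU alpha0).
Qed.

Lemma repelling_nbhd_bigcup (I : finType) (Q : pred I) (N : I -> set X) :
  (forall i, repelling_nbhd f (N i)) ->
  repelling_nbhd f (\bigcup_(i in [set i | Q i]) N i).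
Proof.
move=> rN; rewrite /repelling_nbhd alpha_bigcup; apply: bigcup_sub => i Qi.
by apply: subset_trans (rN i) _; apply: interiorS; apply: bigcup_sup.
Qed.

End Repellers.

(** * Small neighborhoods in a compact metric space *)

Section EpsNbhd.
Context {K : realType} {X : metricType K}.
Implicit Types (A B V : set X) (e : K).

Lemma eps_nbhd_le A e1 e2 : e1 <= e2 -> eps_nbhd e1 A `<=` eps_nbhd e2 A.
Proof. by move=> e12 x [a Aa xa]; exists a => //; apply: le_ball xa. Qed.

Lemma sub_interior_eps_nbhd A e : 0 < e -> A `<=` interior (eps_nbhd e A).
Proof.
move=> e0 x Ax; apply: (interiorS (bigcup_sup Ax)).
exact: nbhsx_ballx.
Qed.

(** Uniform in [y] and [e] at once, which is the shape needed by the
    near-covering form of compactness. *)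
Lemma near_eps_nbhdC A (x : X) : closed A -> ~ A x ->
  \forall y \near x & e \near 0^'+, ~ eps_nbhd e A y.
Proof.
move=> cA nAx.
have /nbhs_ballP[r /= r0 xrA] : nbhs x (~` A).
  by apply: open_nbhs_nbhs; split=> //; apply: closed_openC.
near=> y e => -[a Aa aey]; apply: (xrA a) Aa.
rewrite (splitr r); apply: (@ball_triangle _ _ y).
  by near: y; apply: near_ball; rewrite divr_gt0.
apply: ball_sym; apply: le_ball aey => /=; near: e.
by apply: nbhs_right_le; rewrite divr_gt0.
Unshelve. all: by end_near. Qed.

(** Near a point outside [A `&` B] one of the two neighborhoods is empty, and a
    point of [A `&` B] is interior to [V]; compactness makes [e] uniform. *)
Lemma near_eps_nbhdI A B V : compact [set: X] -> closed A -> closed B ->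
    A `&` B `<=` interior V ->
  \forall e \near (0 : K)^'+, eps_nbhd e A `&` eps_nbhd e B `<=` V.
Proof.
move=> /compact_near_coveringP cX cA cB ABV.
pose good e (x : X) := eps_nbhd e A x -> eps_nbhd e B x -> V x.
suff : \forall e \near (0 : K)^'+, [set: X] `<=` good e.
  by apply: filterS => e gd x [Ax Bx]; apply: gd.
apply: cX => x _.
have [Ax|nAx] := pselect (A x); last first.
  by apply: filterS (near_eps_nbhdC _ _ cA nAx) => -[y e] /= nA /nA.
have [Bx|nBx] := pselect (B x); last first.
  by apply: filterS (near_eps_nbhdC _ _ cB nBx) => -[y e] /= nB _ /nB.
by near=> y e => _ _ /=; near: y; apply: ABV.
Unshelve. all: by end_near. Qed.

Lemma near_eps_nbhd A V : compact [set: X] -> closed A -> A `<=` interior V ->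
  \forall e \near (0 : K)^'+, eps_nbhd e A `<=` V.
Proof.
move=> cX cA AV.
have := near_eps_nbhdI _ _ V cX cA cA; rewrite !setIid => /(_ AV).
by apply: filterS => e; rewrite setIid.
Qed.

End EpsNbhd.

(** * Maps on the lattice of down-sets *)

Section DownsetMaps.
Context {d : Order.disp_t} {P : finPOrderType d} {X : Type}.
Implicit Types (b : downset P) (R : downset P -> set X).

Lemma downset_le b x y : y \in (b : {set P}) -> (x <= y)%O ->
  x \in (b : {set P}).
Proof. by have /is_downsetP := downset_setP b; apply. Qed.

Lemma downset_join_principal b :
  b = \big[Order.join/Order.bottom]_(q in (b : {set P})) principal q.
Proof.
apply/val_inj.
rewrite (big_morph val (id1 := finset.set0) (op1 := @finset.setU P))//.
apply/setP => x; apply/idP/finset.bigcupP => [xb|[q qb]].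
  by exists x => //; rewrite inE.
by rewrite inE; apply: downset_le qb.
Qed.

(** The [principal q] with [q] in [b] are finitely many and [b] is their join,
    so preservation of finite joins applies. *)
Lemma hom_bigcup_principal R b : bounded_lattice_hom R ->
  R b = \bigcup_(q in [set q | q \in (b : {set P})]) R (principal q).
Proof.
move=> [R0 _ RU _].
rewrite (bigcup_pred (mem (b : {set P})) (fun q => R (principal q))).
by rewrite {1}(downset_join_principal b) (big_morph R RU R0).
Qed.

Context {n : nat} (p : 'I_n -> P).
Implicit Types (N : 'I_n -> set X).

(** The closed form of the recursion in [determined_by]. *)
Definition downset_union N b : set X :=
  \bigcup_(i in [set i | p i \in (b : {set P})]) N i.

(** The only condition of substance is the one for meets, and it needs to be
    checked on pairs of principal down-sets only: [p r] below [p i] and [p j]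
    lies in both down-sets, as these are closed downwards. *)
Lemma downset_union_hom N :
  (forall x, exists i, N i x) ->
  (forall i j, N i `&` N j `<=`
    \bigcup_(r in [set r | (p r <= p i)%O && (p r <= p j)%O]) N r) ->
  bounded_lattice_hom (downset_union N).
Proof.
move=> Ncover Nmeet; split.
- by apply/seteqP; split=> // x [i /=]; rewrite inE.
- apply/seteqP; split=> // x _; have [i Nx] := Ncover x.
  by exists i => //=; rewrite inE.
- move=> a b; apply/seteqP; split=> x.
    by move=> [i /setUP[ia|ib] Nx]; [left|right]; exists i.
  by move=> [[i ia Nx]|[i ib Nx]]; exists i => //; apply/setUP; [left|right].
- move=> a b; apply/seteqP; split=> x.
    by move=> [i /setIP[ia ib] Nx]; split; exists i.
  move=> [[i ia Nix] [j jb Njx]].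
  have [r /= /andP[ri rj] Nrx] := Nmeet i j x (conj Nix Njx).
  exists r => //; apply/setIP; split.
    exact: downset_le ia ri.
  exact: downset_le jb rj.
Qed.

Hypothesis p_mono : forall i j, (p i <= p j)%O -> (i <= j)%N.

Lemma label_inj : injective p.
Proof.
by move=> i j pij; apply/val_inj/eqP; rewrite eqn_leq !p_mono ?pij.
Qed.

Lemma downset_union_principal N j : downset_union N (principal (p j)) =
  N j `|` downset_union N (principal_pred (p j)).
Proof.
apply/seteqP; split=> x.
  move=> [i /=]; rewrite inE => ij Nx; have [->|ji] := eqVneq j i; [by left|right].
  by exists i => //=; rewrite !inE ij andbT (inj_eq label_inj) eq_sym.
move=> [Nx|[i /=]]; first by exists j => //=; rewrite inE.
by rewrite !inE => /andP[_ ij] Nx; exists i => //=; rewrite inE.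
Qed.

Lemma downset_union_join N b : downset_union N b =
  \bigcup_(i in [set i | p i \in (b : {set P})])
    downset_union N (principal (p i)).
Proof.
apply/seteqP; split=> x.
  by move=> [i ib Nx]; exists i => //; exists i => //=; rewrite inE.
move=> [i /= ib [j /=]]; rewrite inE => ji Nx; exists j => //=.
exact: downset_le ib ji.
Qed.

Lemma downset_union_determined N : determined_by p N (downset_union N).
Proof.
split=> [i i0|i j _||]; first 3 last.
- exact: downset_union_join.
- rewrite downset_union_principal -[RHS]setU0; congr (_ `|` _).
  apply/seteqP; split=> // x [j /=]; rewrite !inE => /andP[/eqP ji] /p_mono.
  by rewrite i0 leqn0 => /eqP j0; case: ji; congr p; apply: val_inj; rewrite /= i0.
- exact: downset_union_principal.
- by apply/seteqP; split=> // x [i /=]; rewrite inE.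
Qed.

(** Induction on the label: the elements strictly below [p j] have smaller
    labels, so the values on their principal down-sets are already known.  The
    first label falls under the same scheme, as its element is minimal. *)
Lemma determined_by_unique N U :
  determined_by p N U -> U = downset_union N.
Proof.
move=> [U0 US _ Uj].
suff Up k (i : 'I_n) : (i < k)%N ->
    U (principal (p i)) = downset_union N (principal (p i)).
  apply/funext => b; rewrite Uj downset_union_join; apply: eq_bigcupr => i _.
  exact: (Up i.+1).
elim: k i => // k IH i; rewrite ltnS => ik; case: (posnP i) => i0.
  have [D0 _ _ _] := downset_union_determined N.
  by rewrite U0// D0.
have lt_i : (i.-1 < n)%N by rewrite (leq_ltn_trans (leq_pred _)).
rewrite (US (Ordinal lt_i)) /= ?prednK// downset_union_principal; congr (_ `|` _).
rewrite Uj downset_union_join; apply: eq_bigcupr => j /=.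
rewrite !inE => /andP[/eqP ji /p_mono]; rewrite leq_eqVlt => /predU1P[|lt_ji].
  by move/val_inj => eji; rewrite eji in ji.
by apply: IH; apply: leq_trans lt_ji ik.
Qed.

End DownsetMaps.

(** * Choice of the radii *)

(** Dependent choice along ['I_n]: a stage may look only at the values chosen at
    smaller indices, so extending a partial choice never spoils an earlier
    stage. *)
Lemma finite_greedy_choice {T : Type} {n : nat}
    (Q : 'I_n -> ('I_n -> T) -> T -> Prop) (t0 : T) :
  (forall (i : 'I_n) e1 e2 t, (forall j : 'I_n, (j < i)%N -> e1 j = e2 j) ->
     Q i e1 t -> Q i e2 t) ->
  (forall (i : 'I_n) e, (forall j : 'I_n, (j < i)%N -> Q j e (e j)) ->
     exists t, Q i e t) ->
  exists e, forall i, Q i e (e i).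
Proof.
move=> loc step.
suff prefix k : (k <= n)%N ->
    exists e, forall i : 'I_n, (i < k)%N -> Q i e (e i).
  by have [e eQ] := prefix n (leqnn n); exists e => i; apply: eQ.
elim: k => [_|k IH kn]; first by exists (fun=> t0).
have [e eQ] := IH (ltnW kn); have [t et] := step (Ordinal kn) e eQ.
(* Only the value at [k] changes, and stages up to [k] do not see it as part
   of their past. *)
pose e' (i : 'I_n) := if i == k :> nat then t else e i.
have ee' i : (i <= k)%N -> forall j : 'I_n, (j < i)%N -> e j = e' j.
  by move=> ik j ji; rewrite /e' ltn_eqF//; apply: leq_trans ji ik.
exists e' => i; rewrite ltnS leq_eqVlt => /predU1P[ik|ik].
  have -> : e' i = t by rewrite /e' ik eqxx.
  have -> : i = Ordinal kn by apply: val_inj.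
  by apply: loc et; apply: ee'.
rewrite -[e' i](ee' k)//; apply: loc (eQ i ik).
by apply: ee'; apply: ltnW.
Qed.

Section Radii.
Context {K : realType} {X : metricType K} {n : nat}.
Context (A W : 'I_n -> set X) (le : rel 'I_n).

(** Here [le] stands for the order of [P] read on labels, and [W i] for a
    repelling neighborhood with repeller [A i].  The last field concerns every
    [j] that is not above [i], although its radius may still be unknown: it uses
    the common radius [e] for [i] and [j], so it stays true when the radius of a
    later [j] is taken at most [e].  The halves [eps r / 2] are the inner radii
    guaranteed for the neighborhoods to be built. *)
Record admissible (i : 'I_n) (eps : 'I_n -> K) (e : K) : Prop := Admissible {
  admissible_gt0 : 0 < e;
  admissible_le : forall j : 'I_n, (j < i)%N -> e <= eps j;
  admissible_sub : eps_nbhd e (A i) `<=` W i;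
  admissible_meet : forall j : 'I_n, ~~ le i j ->
    eps_nbhd e (A i) `&` eps_nbhd e (A j) `<=`
    \bigcup_(r in [set r | le r i && le r j]) eps_nbhd (eps r / 2) (A r) }.

(** Each field of [admissible] holds for all small [e > 0]; in the last one [r]
    ranges over labels smaller than [i], where positive radii are available. *)
Lemma exists_admissible_radii :
  (forall i j, le i j -> (i <= j)%N) ->
  compact [set: X] ->
  (forall i, closed (A i)) -> (forall i, A i `<=` interior (W i)) ->
  (forall i j, A i `&` A j `<=`
     \bigcup_(r in [set r | le r i && le r j]) A r) ->
  exists eps, forall i, admissible i eps (eps i).
Proof.
move=> le_label cX cA AW AI; apply: (finite_greedy_choice _ 1).
  move=> i e1 e2 t e12 [t0 t1 tW tI]; split=> //.
    by move=> j ji; rewrite -e12//; apply: t1.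
  move=> j ij x /(tI j ij)[r /= /andP[ri rj]]; rewrite e12.
    by exists r => //=; rewrite ri.
  rewrite ltn_neqAle le_label// andbT.
  by apply: contraNneq ij => /val_inj <-.
move=> i eps epsQ.
have lt_label j r : ~~ le i j -> le r i && le r j -> (r < i)%N.
  move=> ij /andP[ri rj]; rewrite ltn_neqAle le_label// andbT.
  by apply: contraNneq ij => /val_inj <-.
have eps0 j r : ~~ le i j -> le r i && le r j -> 0 < eps r / 2.
  by move=> ij /(lt_label _ _ ij)/epsQ/admissible_gt0 e0; rewrite divr_gt0.
suff : \forall e \near (0 : K)^'+, admissible i eps e.
  exact: (@filter_ex _ _ (at_right_proper_filter 0)).
near=> e; split; near: e.
- exact: nbhs_right_gt.
- apply: filter_forall => j; have [ji|_] := boolP (j < i)%N; last exact: nearW.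
  by apply: filterS (nbhs_right_le (admissible_gt0 _ _ _ (epsQ j ji))) => e.
- exact: near_eps_nbhd.
- apply: filter_forall => j; have [_|ij] := boolP (le i j).
    by apply: nearW.
  set V := \bigcup_(r in _) _.
  have AijV : A i `&` A j `<=` interior V.
    apply: subset_trans (AI i j) _; apply: bigcup_sub => r /= rij x Ax.
    apply: (interiorS (bigcup_sup (rij : [set r | le r i && le r j] r))).
    by apply: sub_interior_eps_nbhd Ax; apply: (eps0 j).
  by apply: filterS (near_eps_nbhdI _ _ _ cX (cA i) (cA j) AijV) => e.
Unshelve. all: by end_near. Qed.

(** By symmetry let [i] be the smaller label.  If [le i j] the index [i] itself
    serves as [r]; otherwise the condition imposed at stage [i] applies, the
    radius of [j] being at most that of [i]. *)
Lemma admissible_nbhd_meet (eps : 'I_n -> K) (N : 'I_n -> set X) :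
  (forall i, le i i) ->
  (forall i, admissible i eps (eps i)) ->
  (forall i, eps_nbhd (eps i / 2) (A i) `<=` N i) ->
  (forall i, N i `<=` eps_nbhd (eps i) (A i)) ->
  forall i j, N i `&` N j `<=` \bigcup_(r in [set r | le r i && le r j]) N r.
Proof.
move=> le_refl adm AN NA.
suff H (i j : 'I_n) : (i <= j)%N -> N i `&` N j `<=`
    \bigcup_(r in [set r | le r i && le r j]) N r.
  move=> i j; have [/H//|/ltnW/H ji] := leqP i j.
  by rewrite setIC; under eq_set do rewrite andbC.
move=> ij x [Nix Njx]; have [lij|nlij] := boolP (le i j).
  by exists i => //=; rewrite le_refl.
have epsij : eps j <= eps i.
  move: ij; rewrite leq_eqVlt => /predU1P[/val_inj <-//|].
  exact: admissible_le (adm j) _.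
have [] := admissible_meet _ _ _ (adm i) _ nlij x.
  by split; [exact: NA|apply: eps_nbhd_le epsij _ _; exact: NA].
by move=> r rij Arx; exists r => //; apply: AN.
Qed.

End Radii.

(** * The lift *)

Theorem theorem4p22 (K : realType) (X : metricType K) (f : X -> X)
    (d : Order.disp_t) (P : finPOrderType d) (I : nat)
    (L : set (set X)) (R : downset P -> set X)
    (pi : P -> 'I_I) (p : 'I_I -> P) :
  compact [set: X] ->
  continuous f ->
  #|P| = I ->
  sublattice_of [set A | repeller f A] L ->
  bounded_lattice_hom R ->
  set_bij [set: downset P] L R ->
  bijective pi ->
  {homo pi : x y / (x <= y)%O >-> (x <= y)%N} ->
  cancel pi p ->
  exists eps : 'I_I -> K,
    (forall i, 0 < eps i) /\
    forall N : 'I_I -> set X,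
      (forall i, [/\ compact (N i),
          eps_nbhd (eps i / 2) (R (principal (p i))) `<=` N i &
          N i `<=` eps_nbhd (eps i) (R (principal (p i)))]) ->
      (forall i, repelling_nbhd f (N i)) /\
      exists U : downset P -> set X,
        [/\ determined_by p N U,
            (forall V : downset P -> set X, determined_by p N V -> V = U),
            bounded_lattice_hom U,
            (forall beta, repelling_nbhd f (U beta)) &
            (forall beta, alpha f (U beta) = R beta)].
Proof.
move=> cX cf _ [Lrep _ _ _ _] hR /set_bij_homo Rsub pi_bij pi_mono piK.
have pK : cancel p pi by apply/(bij_can_sym pi_bij).
have p_mono i j : (p i <= p j)%O -> (i <= j)%N by move/pi_mono; rewrite !pK.
pose A i := R (principal (p i)).
pose le : rel 'I_I := fun i j => (p i <= p j)%O.
have RE b : R b = \bigcup_(i in [set i | p i \in (b : {set P})]) A i.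
  rewrite hom_bigcup_principal//; apply/seteqP; split=> x [q /= qb Rx].
    by exists (pi q) => /=; rewrite /A piK.
  by exists (p q).
have /choice[W WP] : forall i, exists W, repelling_nbhd f W /\ A i = alpha f W.
  by move=> i; have [W rW AW] := Lrep _ (Rsub (principal (p i)) Logic.I); exists W.
have [eps adm] : exists eps, forall i, admissible A W le i eps (eps i).
  apply: exists_admissible_radii => //.
  - by move=> i; rewrite (WP i).2; apply: closed_alpha.
  - by move=> i; rewrite (WP i).2; apply: (WP i).1.
  - move=> i j; have [_ _ _ /(_ (principal (p i)) (principal (p j)))] := hR.
    rewrite RE => AI x Aij.
    have : (R (principal (p i)) `&` R (principal (p j))) x by [].
    rewrite -[X in X x]AI => -[r /= /setIP[]]; rewrite !inE => ri rj Ax.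
    by exists r => //=; rewrite /le ri.
have eps0 i : 0 < eps i := admissible_gt0 _ _ _ _ _ _ (adm i).
exists eps; split=> // N hN.
have AN i : eps_nbhd (eps i / 2) (A i) `<=` N i by have [] := hN i.
have NA i : N i `<=` eps_nbhd (eps i) (A i) by have [] := hN i.
have AiN i : A i `<=` interior (N i).
  apply: subset_trans (interiorS (AN i)).
  by apply: sub_interior_eps_nbhd; rewrite divr_gt0.
have aN i : alpha f (N i) = A i.
  rewrite (WP i).2; apply: alpha_squeeze => //; first by rewrite -(WP i).2.
  exact: subset_trans (NA i) (admissible_sub _ _ _ _ _ _ (adm i)).
have rN i : repelling_nbhd f (N i) by rewrite /repelling_nbhd aN.
split=> //; exists (downset_union p N); split.
- exact: downset_union_determined.
- by move=> V; apply: determined_by_unique.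
- apply: downset_union_hom.
    move=> x; have [_ RT _ _] := hR.
    have : R \top%O x by rewrite RT.
    rewrite RE => -[i _ Ax]; exists i.
    by apply: interior_subset; apply: AiN.
  by apply: (admissible_nbhd_meet A W le eps) => // i; apply: lexx.
- by move=> b; apply: repelling_nbhd_bigcup.
- move=> b; rewrite RE /downset_union alpha_bigcup.
  by apply: eq_bigcupr => i _; apply: aN.
Qed.
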